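(* Let $\mathcal A$ and $\mathcal B$ be two Tauberian BSE-algebras satisfying condition $(M)$, each of which has a $1$-bounded approximate identity. If there exists a bijective separating linear map $T:\mathcal A\to\mathcal B$, then $\mathcal A$ and $\mathcal B$ are algebraically isomorphic.
   Context: For a commutative Banach algebra $\mathcal{A}$ (over $\mathbb{C}$), $\Omega_{\mathcal{A}}$ is its maximal ideal (character) space with the Gelfand topology, $\widehat{a}$ is the Gelfand transform of $a$, and $\operatorname{supp}(\widehat a)$ is the closure of $\{x\in\Omega_{\mathcal A}:\widehat a(x)\ne0\}$. $\mathcal{A}$ is semisimple if $\bigcap_{x\in\Omega_{\mathcal A}}\ker x=\{0\}$. $\mathcal{A}$ is regular if for every $x\in\Omega_{\mathcal A}$ and open neighbourhood $U$ of $x$ there is $a\in\mathcal A$ with $\widehat a(x)=1$ and $\widehat a=0$ on $\Omega_{\mathcal A}\setminus U$. $\mathcal A_c$ is the set of $a\in\mathcal A$ with $\operatorname{supp}(\widehat a)$ compact. A Tauberian algebra is a semisimple commutative Banach algebra $\mathcal A$ in which $\mathcal A_c$ is dense. Condition $(M)$: $\mathcal A$ is regular and for each $x\in\Omega_{\mathcal A}$, each $a\in\mathcal A$ with $\widehat a(x)=0$, and each neighbourhood $U$ of $x$, $\inf\{\|ba\|_{\mathcal A}: b\in\mathcal A,\ \widehat b|_V\equiv1 \text{ for some neighbourhood } V \text{ of } x,\ \operatorname{supp}(\widehat b)\subseteq U\}=0$. A linear map $T:\mathcal A\to\mathcal B$ is separating if $a_1a_2=0$ implies $Ta_1\,Ta_2=0$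 for all $a_1,a_2\in\mathcal A$. A $1$-bounded approximate identity is an approximate identity $(e_\alpha)$ with $\|e_\alpha\|\le1$ for all $\alpha$. Algebraically isomorphic means that there is a bijective algebra homomorphism between them. A multiplier of $\mathcal B$ is a bounded linear operator $S:\mathcal B\to\mathcal B$ with $a(Sb)=(Sa)b$ for all $a,b\in\mathcal B$; $M(\mathcal B)$ is the algebra of all multipliers. For semisimple $\mathcal B$, each $S\in M(\mathcal B)$ is identified with the bounded continuous function $\phi$ on $\Omega_{\mathcal B}$ with $\widehat{Sb}=\phi\,\widehat b$ for all $b\in\mathcal B$. A function $\varphi:\Omega_{\mathcal B}\to\mathbb C$ satisfies the BSE-condition if there is $C>0$ such that for all finite $\{y_1,\dots,y_n\}\subset\Omega_{\mathcal B}$ and $\alpha_1,\dots,\alpha_n\in\mathbb C$, $|\sum_i\alpha_i\varphi(y_i)|\le C\|\sum_i\alpha_iy_i\|_{\mathcal B^*}$. $\mathcal B$ is a BSE-algebra if the set of continuous functions on $\Omega_{\mathcal B}$ satisfying the BSE-condition equals $M(\mathcal B)$ (where each multiplier $S\in M(\mathcal B)$ is identified with the function $\phi$ on $\Omega_{\mathcal B}$ such that $\widehat{Sb}=\phi\,\widehat b$ for all $b\in\mathcal B$). *)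

(* Defs.v *)
From HB Require Import structures.
From mathcomp Require Import all_boot all_order all_algebra.
From mathcomp Require Import complex.
From mathcomp Require Import all_classical all_reals all_analysis.

Set Implicit Arguments.
Unset Strict Implicit.
Unset Printing Implicit Defensive.

Import Order.TTheory GRing.Theory Num.Theory.
Import numFieldNormedType.Exports.

Local Open Scope classical_set_scope.
Local Open Scope ring_scope.
Local Open Scope complex_scope.

(* Banach algebras need not have a unit, so the product is not the ring
   product of an [algType]. *)
HB.mixin Record CompleteNormedModule_isComBanachAlgebra (R : realType) A
    of CompleteNormedModule R[i] A := {
  bmul : A -> A -> A;
  bmulA : associative bmul;
  bmulC : commutative bmul;
  bmulDl : left_distributive bmul +%R;
  bmulZl : forall (c : R[i]) (a b : A), bmul (c *: a) b = c *: bmul a b;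
  normr_bmul : forall a b : A, `|bmul a b| <= `|a| * `|b| }.

#[short(type="comBanachAlgType")]
HB.structure Definition ComBanachAlgebra (R : realType) :=
  { A of CompleteNormedModule_isComBanachAlgebra R A
       & CompleteNormedModule R[i] A }.

Local Notation "a ⋅ b" := (bmul a b) (at level 40, left associativity).

(* Norms on complex normed modules are valued in [R[i]]; they are real. *)
Definition rnorm (R : realType) (V : normedModType R[i]) (v : V) : R :=
  complex.Re `|v|.

Section GelfandTheory.
Context (R : realType) (A : comBanachAlgType R).

Record character := Character {
  character_fun :> {scalar A};
  characterM : forall a b, character_fun (a ⋅ b) =
                           character_fun a * character_fun b;
  character_neq0 : exists a, character_fun a != 0 }.

HB.instance Definition _ := gen_eqMixin character.
HB.instance Definition _ := gen_choiceMixin character.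

(* The Gelfand topology is the topology of pointwise convergence on A. *)
Definition character_eval (x : character) : {ptws A -> R[i]^o} := x.

HB.instance Definition _ :=
  Topological.copy character (initial_topology character_eval).

Definition gelfand (a : A) : character -> R[i] := fun x => x a.

Definition gelfand_supp (a : A) : set character :=
  closure [set x | gelfand a x != 0].

Definition semisimple : Prop :=
  \bigcap_(x in [set: character]) [set a : A | x a = 0] = [set 0].

Definition regular : Prop :=
  forall (x : character) (U : set character), open_nbhs x U ->
    exists a : A, gelfand a x = 1 /\ forall y, ~ U y -> gelfand a y = 0.

Definition compactly_supported : set A := [set a | compact (gelfand_supp a)].

Definition tauberian : Prop := semisimple /\ dense compactly_supported.

(* The infimum is taken in [\bar R], so that it is [+oo] on the empty set. *)
Definition condition_M : Prop :=
  regular /\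
  forall (x : character) (a : A) (U : set character),
    gelfand a x = 0 -> nbhs x U ->
    ereal_inf [set (rnorm (b ⋅ a))%:E | b in
      [set b : A |
        (exists2 V : set character, nbhs x V & forall y, V y -> gelfand b y = 1)
        /\ gelfand_supp b `<=` U]] = 0%E.

(* Directed index sets are preorders, as usual for nets. *)
Definition directed (I : Type) (le : I -> I -> Prop) : Prop :=
  [/\ inhabited I, forall i, le i i,
      forall i j k, le i j -> le j k -> le i k &
      forall i j, exists k, le i k /\ le j k].

Definition net_filter (I : Type) (le : I -> I -> Prop) : set_system I :=
  [set S | exists i0, forall i, le i0 i -> S i].

Definition has_bounded_approx_identity (M : R) : Prop :=
  exists (I : Type) (le : I -> I -> Prop) (e : I -> A),
    [/\ directed le, forall i, rnorm (e i) <= M &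
        forall a : A, (e i ⋅ a) @[i --> net_filter le] --> a].

Definition multiplier : set (A -> A) :=
  [set S | [/\ linear S,
               exists M : R, forall b, rnorm (S b) <= M * rnorm b &
               forall a b, a ⋅ S b = S a ⋅ b]].

Definition multiplier_symbols : set (character -> R[i]) :=
  [set phi | exists2 S, multiplier S &
     forall (b : A) (x : character), gelfand (S b) x = phi x * gelfand b x].

Definition dual_norm (f : A -> R[i]) : \bar R :=
  ereal_sup [set (rnorm (f a : R[i]^o))%:E | a in [set a : A | rnorm a <= 1]].

(* Finite subsets of the character space are duplicate-free sequences. *)
Definition BSE_condition (phi : character -> R[i]) : Prop :=
  exists2 C : R, 0 < C &
    forall (ys : seq character) (alpha : character -> R[i]), uniq ys ->
      ((rnorm (\sum_(y <- ys) alpha y * phi y : R[i]^o)%R)%:E <=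
       C%:E * dual_norm (fun a => (\sum_(y <- ys) alpha y * y a)%R))%E.

Definition BSE_algebra : Prop :=
  [set phi : character -> R[i] |
     continuous (phi : character -> R[i]^o) /\ BSE_condition phi] =
  multiplier_symbols.

End GelfandTheory.

Arguments semisimple {R} A.
Arguments regular {R} A.
Arguments tauberian {R} A.
Arguments condition_M {R} A.
Arguments has_bounded_approx_identity {R} A M.
Arguments BSE_algebra {R} A.

Definition separating (R : realType) (A B : comBanachAlgType R) (T : A -> B) :
    Prop :=
  forall a1 a2 : A, a1 ⋅ a2 = 0 -> T a1 ⋅ T a2 = 0.

Definition algebraically_isomorphic (R : realType) (A B : comBanachAlgType R) :
    Prop :=
  exists Phi : {linear A -> B},
    bijective Phi /\ forall a b : A, Phi (a ⋅ b) = Phi a ⋅ Phi b.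

(* Main.v *)
Require Import Defs.
From HB Require Import structures.
From mathcomp Require Import all_boot all_order all_algebra.
From mathcomp Require Import complex.
From mathcomp Require Import all_classical all_reals all_analysis.
From mathcomp Require Import lra ring.

(** A separating bijection [T] is shown to be a bounded weighted composition
    operator, [y (T a) = kappa y * (h y) a], and the BSE property is used to
    divide the weight [kappa] out.

    Fix a character [y] of [B] and look at the functional [a |-> y (T a)].  It is
    separating, and it is concentrated at a character [x] of [A] (a
    support point): a compactness argument with bump functions produces [x] as
    soon as the functional is nonzero on some compactly supported element
    ([support_point_exists]), and elements vanishing near [x] are then killed
    ([separating_functional_local]).  If the functional is moreover bounded, then
    condition (M), which lets one approximate each [a] in the kernel of [x] by
    elements vanishing near [x], makes it a nonzero multiple of [x]
    ([bounded_separating_functional]).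

    Boundedness is not assumed but follows.  Suppose [T c] vanishes at every [y]
    with a bounded functional.  If [c] were nonzero, all support points in the
    open set where the transform of [c] is nonzero would come from unbounded
    functionals.  Since [T] is injective, support points are dense
    ([support_points_dense]), so infinitely many of them can be put in disjoint
    open sets, and a sliding hump yields one element [s] for which [T s] would have
    infinite norm ([no_open_set_of_unbounded_pullbacks]).  Hence the bounded functionals
    separate the points of the range ([eq0_of_bounded_pullbacks]), the graph of
    [T] is closed, and [T] is bounded ([separating_bijection_bounded]).
    Boundedness and the density of the compactly supported elements then give
    every [y] a support point, hence [h] and [kappa].  Density of the support
    points also shows that the inverse of [T] is separating, so the inverse is of
    the same form, [x (T^-1 b) = mu x * (k x) b]; comparing the two expressions,
    [h] and [k] are mutually inverse and [mu (h y) = 1 / kappa y].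

    Evaluating [T] along the bounded approximate identity shows that [kappa]
    satisfies the BSE-condition ([weight_BSE]); it is continuous, so it is the
    symbol of a multiplier of [B], and likewise [mu] is the symbol of a
    multiplier [N] of [A].  In the composite of [N] and [T] the two weights cancel,
    [y (T (N a)) = (h y) a], so it is multiplicative; its inverse is obtained in
    the same way from [kappa]. *)

Local Open Scope ring_scope.

Set Implicit Arguments.
Unset Strict Implicit.
Unset Printing Implicit Defensive.

Import Order.TTheory GRing.Theory Num.Theory.
Import numFieldNormedType.Exports.

Local Open Scope classical_set_scope.
Local Open Scope complex_scope.

Local Notation "a ⋅ b" := (bmul a b) (at level 40, left associativity).

(** * Real-valued norms and geometrically convergent series *)

Section RealNorm.
Context (R : realType) (V : normedModType R[i]).
Implicit Types u v w : V.

Lemma normr_rnorm v : `|v| = (rnorm v)%:C.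
Proof. by rewrite /rnorm RRe_real ?normr_real. Qed.

Lemma rnorm_ge0 v : 0 <= rnorm v.
Proof. by rewrite -ler0c -normr_rnorm. Qed.

Lemma rnorm0 : rnorm (0 : V) = 0.
Proof. by rewrite /rnorm normr0. Qed.

Lemma rnorm_eq0 v : rnorm v = 0 -> v = 0.
Proof. by move=> v0; apply/normr0_eq0; rewrite normr_rnorm v0. Qed.

Lemma rnorm_gt0 v : v != 0 -> 0 < rnorm v.
Proof.
move=> v0; rewrite lt_neqAle rnorm_ge0 andbT eq_sym.
by apply: contraNneq v0 => /rnorm_eq0 ->.
Qed.

Lemma rnorm_small_eq0 v : (forall e, 0 < e -> rnorm v <= e) -> v = 0.
Proof.
move=> ve; apply: rnorm_eq0; apply/eqP; rewrite eq_le rnorm_ge0 andbT.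
by apply/ler_addgt0Pl => e /ve; rewrite addr0.
Qed.

Lemma rnormN v : rnorm (- v) = rnorm v.
Proof. by rewrite /rnorm normrN. Qed.

Lemma rnormBC u v : rnorm (u - v) = rnorm (v - u).
Proof. by rewrite -rnormN opprB. Qed.

Lemma rnormD u v : rnorm (u + v) <= rnorm u + rnorm v.
Proof. by rewrite -lecR raddfD /= -!normr_rnorm ler_normD. Qed.

Lemma rnormB u v : rnorm (u - v) <= rnorm u + rnorm v.
Proof. by rewrite -(rnormN v) rnormD. Qed.

Lemma rnorm_triangle w u v : rnorm (u - v) <= rnorm (u - w) + rnorm (w - v).
Proof. by rewrite -[u - v](subrKA w) rnormD. Qed.

Lemma rnorm_lt v (e : R) : (`|v| < e%:C) = (rnorm v < e).
Proof. by rewrite normr_rnorm ltcR. Qed.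

Lemma nbhs_rnormP v (U : set V) :
  nbhs v U <-> exists2 e : R, 0 < e & forall u, rnorm (u - v) < e -> U u.
Proof.
split.
  move=> /nbhs_normP [e /= e0 eU].
  have eE : e = (complex.Re e)%:C by rewrite RRe_real // gtr0_real.
  exists (complex.Re e); first by rewrite -ltcR -eE.
  by move=> u uv; apply: eU => /=; rewrite eE rnorm_lt rnormBC.
move=> [e e0 eU]; apply/nbhs_normP; exists e%:C; first by rewrite /= ltcR.
by move=> u /=; rewrite rnorm_lt rnormBC; apply: eU.
Qed.

Lemma cvg_rnormP (I : Type) (F : set_system I) (FF : Filter F)
    (f : I -> V) (v : V) :
  (f i @[i --> F] --> v) <->
  forall e : R, 0 < e -> \forall i \near F, rnorm (f i - v) < e.
Proof.
split=> [fv e e0|fv U /nbhs_rnormP [e e0 eU]].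
  have : nbhs v [set u | rnorm (u - v) < e] by apply/nbhs_rnormP; exists e.
  by move=> /fv.
by apply: (filterS _ (fv e e0)) => i; apply: eU.
Qed.

End RealNorm.

Lemma rnormZ (R : realType) (V : normedModType R[i]) (c : R[i]) (v : V) : rnorm (c *: v) = rnorm (c : R[i]^o) * rnorm v.
Proof.
by apply: (@complexI R); rewrite rmorphM /= -!normr_rnorm normrZ.
Qed.

Lemma rnorm_real (R : realType) (r : R) : 0 <= r -> rnorm (r%:C : R[i]^o) = r.
Proof.
move=> r0; apply: (@complexI R); rewrite -normr_rnorm ger0_norm //.
by rewrite ler0c.
Qed.

Lemma rnormM (R : realType) (c d : R[i]) :
  rnorm (c * d : R[i]^o) = rnorm (c : R[i]^o) * rnorm (d : R[i]^o).
Proof.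
by apply: (@complexI R); rewrite rmorphM /= -!normr_rnorm normrM.
Qed.

Lemma rnormZr (R : realType) (V : normedModType R[i]) (r : R) (v : V) : 0 <= r -> rnorm (r%:C *: v) = r * rnorm v.
Proof. by move=> r0; rewrite rnormZ rnorm_real. Qed.


Lemma half_pow_lt (R : realType) (C e : R) : 0 < e ->
  exists n : nat, C * (2^-1) ^+ n < e.
Proof.
move=> e0.
have : (fun n => C * (2^-1) ^+ n) @ \oo --> (C * 0 : R).
  by apply: cvgMr; apply: cvg_expr; rewrite ger0_norm; lra.
rewrite mulr0 => /cvgr_lt /(_ _ e0) [n _ nP]; exists n.
by apply: nP => /=.
Qed.

Lemma rnorm_half_pow_eq0 (R : realType) (V : normedModType R[i]) (C : R) (v : V) :
  (forall n, rnorm v <= C * (2^-1) ^+ n) -> v = 0.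
Proof.
move=> vC; apply: rnorm_small_eq0 => e /(half_pow_lt C) [n ne].
exact: le_trans (vC n) (ltW ne).
Qed.

(** The common source of all limits taken here: it yields sums of geometric
    series, the point common to nested balls in the category argument, and it
    comes with the explicit error bound that the later estimates rely on. *)
Lemma halving_sequence_limit (R : realType) (V : completeNormedModType R[i])
    (a : nat -> V) (r : nat -> R) :
  (forall n, r n.+1 <= r n / 2) ->
  (forall n, rnorm (a n.+1 - a n) <= r n) ->
  exists s, forall n, rnorm (s - a n) <= 2 * r n.
Proof.
move=> rS ar.
have r_ge0 n : 0 <= r n by apply: le_trans (ar n); apply: rnorm_ge0.
have rE n k : r (n + k)%N <= r n * (2^-1) ^+ k.
  elim: k => [|k IH]; first by rewrite addn0 expr0 mulr1.
  rewrite addnS exprSr mulrA; apply: le_trans (rS _) _.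
  by rewrite ler_pM2r.
have aE n k : rnorm (a (n + k)%N - a n) <= 2 * r n - 2 * r (n + k)%N.
  elim: k => [|k IH]; first by rewrite addn0 subrr rnorm0 subrr.
  have := rnorm_triangle (a (n + k)%N) (a (n + k.+1)%N) (a n).
  rewrite addnS; have := ar (n + k)%N; have := rS (n + k)%N; lra.
have aE' n m : (n <= m)%N -> rnorm (a m - a n) <= 2 * r n.
  by move=> nm; have := aE n (m - n)%N; rewrite subnKC //; have := r_ge0 m; lra.
have /cauchy_cvgP : cauchy (a @ \oo).
  apply/cauchy_exP => e e0.
  have eE : e = (complex.Re e)%:C by rewrite RRe_real // gtr0_real.
  have e'0 : 0 < complex.Re e by rewrite -ltcR -eE.
  have [n nP] := half_pow_lt (2 * r 0%N) e'0.
  exists (a n); exists n => // m /= nm.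
  rewrite -ball_normE /ball_ /= eE rnorm_lt rnormBC.
  apply: le_lt_trans (aE' _ _ nm) _; apply: le_lt_trans nP.
  by rewrite -mulrA ler_pM2l //; have := rE 0%N n; rewrite add0n.
rewrite cvg_ex => -[s /cvg_rnormP sP]; exists s => n.
apply/ler_addgt0Pr => e e0.
have [m _ mP] := sP _ e0.
have := mP (maxn n m); rewrite /= leq_maxr => /(_ isT) h1.
have h2 := aE' _ _ (leq_maxl n m).
have := rnorm_triangle (a (maxn n m)) s (a n); rewrite (rnormBC s (a (maxn n m))); lra.
Qed.

Lemma geometric_series_limit (R : realType) (V : completeNormedModType R[i])
    (u : nat -> V) (C : R) :
  (forall n, rnorm (u n) <= C * (2^-1) ^+ n) ->
  exists s, forall n, rnorm (s - \sum_(k < n) u k) <= 2 * (C * (2^-1) ^+ n).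
Proof.
move=> uC; apply: halving_sequence_limit => n; first by rewrite exprSr mulrA.
by rewrite big_ord_recr /= addrAC subrr add0r.
Qed.

(** * Characters, bump functions and the Gelfand topology *)

Section BanachAlgebra.
Context (R : realType) (A : comBanachAlgType R).
Implicit Types (a b c : A) (x y z : character A).

Lemma bmulDr a b c : a ⋅ (b + c) = a ⋅ b + a ⋅ c.
Proof. by rewrite bmulC bmulDl !(bmulC a). Qed.

Lemma bmulZr (k : R[i]) a b : a ⋅ (k *: b) = k *: (a ⋅ b).
Proof. by rewrite bmulC bmulZl bmulC. Qed.

Lemma bmul0l a : 0 ⋅ a = 0.
Proof. by rewrite -[X in X ⋅ a](scale0r 0) bmulZl scale0r. Qed.

Lemma bmulNr a b : a ⋅ (- b) = - (a ⋅ b).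
Proof. by rewrite -scaleN1r bmulZr scaleN1r. Qed.

Lemma bmulBr a b c : a ⋅ (b - c) = a ⋅ b - a ⋅ c.
Proof. by rewrite bmulDr bmulNr. Qed.

Lemma rnorm_bmul a b : rnorm (a ⋅ b) <= rnorm a * rnorm b.
Proof. by rewrite -lecR rmorphM /= -!normr_rnorm normr_bmul. Qed.

(** If [x b = 1] for some [b] of norm at most one half, then
    [s = b + b^2 + b^3 + ...] satisfies [s = b + b s], and applying [x] gives
    [x s = 1 + x s].  The constant 2 is not optimal; it lets the series be
    dominated by powers of one half. *)
Lemma character_bounded x a : rnorm (x a : R[i]^o) <= 2 * rnorm a.
Proof.
rewrite leNgt; apply/negP => ax.
have xa0 : x a != 0.
  apply/eqP => xa0; move: ax; rewrite xa0 rnorm0.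
  by have := rnorm_ge0 a; lra.
set b := (x a)^-1 *: a.
have xb : x b = 1 by rewrite scalarZ /= mulVf.
have b_le : rnorm b <= 2^-1.
  rewrite rnormZ; set t := rnorm (_ : R[i]^o).
  have tE : t * rnorm (x a : R[i]^o) = 1.
    by rewrite -rnormM mulVf // (rnorm_real (r := 1)).
  have t0 : 0 <= t by apply: rnorm_ge0.
  have : t * (2 * rnorm a) <= t * rnorm (x a : R[i]^o).
    by apply: ler_wpM2l => //; apply: ltW.
  by rewrite tE; lra.
pose u n := iter n (bmul b) b.
have u_le n : rnorm (u n) <= 2^-1 * (2^-1) ^+ n.
  elim: n => [|n IH]; first by rewrite expr0 mulr1.
  rewrite exprS; apply: le_trans (rnorm_bmul _ _) _.
  by apply: ler_pM => //; apply: rnorm_ge0.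
have [s sP] := geometric_series_limit u_le.
have uS n : \sum_(k < n.+1) u k = b + b ⋅ \sum_(k < n) u k.
  elim: n => [|n IH].
    by rewrite big_ord_recr !big_ord0 /= bmulC bmul0l add0r addr0.
  by rewrite big_ord_recr [in LHS]IH /= [in RHS]big_ord_recr /= bmulDr addrA.
have sE : s = b + b ⋅ s.
  apply/eqP; rewrite -subr_eq0; apply/eqP.
  apply: (rnorm_half_pow_eq0 (C := 1)) => n.
  have h1 := rnorm_triangle (\sum_(k < n.+1) u k) s (b + b ⋅ s).
  rewrite {2}uS opprD addrACA subrr add0r -bmulBr in h1.
  have h2 := rnorm_bmul b (\sum_(k < n) u k - s); rewrite (rnormBC _ s) in h2.
  have h3 : rnorm b * rnorm (s - \sum_(k < n) u k) <=
      2^-1 * rnorm (s - \sum_(k < n) u k).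
    by apply: ler_wpM2r => //; apply: rnorm_ge0.
  have := sP n.+1; have := sP n; rewrite exprS.
  set p := 2^-1 ^+ n; rewrite opprD mul1r; lra.
have : x s = 1 + x s by rewrite {1}sE raddfD /= characterM xb mul1r.
by move/eqP; rewrite -subr_eq subrr eq_sym oner_eq0.
Qed.

Lemma gelfand_continuous a : continuous (gelfand a : character A -> R[i]^o).
Proof.
move=> x; apply: (@continuous_comp _ _ _ (@character_eval R A)
  (fun f : {ptws A -> R[i]^o} => f a)); first exact: initial_continuous.
exact: (@proj_continuous _ (fun _ : A => R[i]^o)).
Qed.

Lemma open_gelfand_neq0 a : open [set x | gelfand a x != 0].
Proof.
have -> : [set x | gelfand a x != 0] =
    (gelfand a : character A -> R[i]^o) @^-1` (~` [set 0]).
  by apply/seteqP; split=> x /=; [move=> /eqP | move=> ?; apply/eqP].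
apply: open_comp => [x _|]; first exact: gelfand_continuous.
apply: closed_openC; apply: accessible_closed_set1.
exact/hausdorff_accessible/norm_hausdorff.
Qed.

Lemma character_inj x y : (forall a, x a = y a) -> x = y.
Proof.
case: x y => [f fM f0] [g gM g0] /= fg.
have {}fg : f = g.
  move: f g fg {fM f0 gM g0} => [f cf] [g cg] /= /funext fg.
  subst g; congr GRing.Linear.Pack.
  case: cf cg => [[m1] [m2]] [[n1] [n2]].
  by rewrite (Prop_irrelevance m1 n1) (Prop_irrelevance m2 n2).
subst g; by rewrite (Prop_irrelevance fM gM) (Prop_irrelevance f0 g0).
Qed.

Lemma character_space_hausdorff : hausdorff_space (character A).
Proof.
rewrite open_hausdorff => x y /eqP xy.
have [a /eqP xya] : exists a, x a <> y a.
  by apply/existsNP => xya; apply: xy; apply: character_inj.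
have := @norm_hausdorff _ (R[i]^o : normedModType R[i]).
rewrite open_hausdorff => /(_ (x a) (y a) xya) [[U V]] /= [xU yV] [oU oV UV].
exists ((gelfand a : character A -> R[i]^o) @^-1` U,
        (gelfand a : character A -> R[i]^o) @^-1` V) => /=.
  by rewrite !inE in xU yV *.
split; try by apply: open_comp => // z _; apply: gelfand_continuous.
by rewrite -preimage_setI (eqP UV) preimage_set0.
Qed.

Lemma semisimple_eq0 a : semisimple A -> (forall x, x a = 0) -> a = 0.
Proof. by move=> ss xa; have : [set 0] a by rewrite -ss => x _; apply: xa. Qed.

Lemma semisimple_inj a b : semisimple A -> (forall x, x a = x b) -> a = b.
Proof.
move=> ss ab; apply/eqP; rewrite -subr_eq0; apply/eqP.
by apply: semisimple_eq0 => // x; rewrite raddfB /= ab subrr.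
Qed.

Lemma tauberian_approx a (e : R) : tauberian A -> 0 < e ->
  exists2 c, compactly_supported c & rnorm (a - c) < e.
Proof.
move=> [_ dA] e0.
have [c [ac cc]] : (ball a e%:C)° `&` compactly_supported (A:=A) !=set0.
  apply: dA; last exact: open_interior.
  by exists a; apply: nbhsx_ballx; rewrite ltcR.
exists c => //; move/interior_subset: ac.
by rewrite -ball_normE /ball_ /= rnorm_lt.
Qed.

Lemma gelfand_eq0_off_supp b (U : set (character A)) :
  gelfand_supp b `<=` U -> forall y, ~ U y -> y b = 0.
Proof.
move=> bU y Uy; apply/eqP/negPn/negP => yb; apply: Uy; apply: bU.
exact: subset_closure.
Qed.

Lemma condition_M_unit x a (U : set (character A)) (e : R) :
  condition_M A -> x a = 0 -> nbhs x U -> 0 < e ->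
  exists b, [/\ nbhs x [set y : character A | y b = 1], gelfand_supp b `<=` U
             & rnorm (b ⋅ a) < e].
Proof.
move=> [_ M] xa xU e0; have := M x a U xa xU.
set S := (X in ereal_inf X) => infS.
have /ereal_inf_lt : (ereal_inf S < e%:E)%E by rewrite infS lte_fin.
move=> [_ [b [[V xV Vb] bU] <-]]; rewrite lte_fin => be; exists b; split => //.
by apply: filterS xV.
Qed.

(** Condition (M) at the zero element provides the local units. *)
Lemma condition_M_bump x (U : set (character A)) :
  condition_M A -> nbhs x U ->
  exists b, nbhs x [set y : character A | y b = 1] /\ gelfand_supp b `<=` U.
Proof.
move=> M xU; have [b [b1 bU _]] := condition_M_unit M (raddf0 x) xU ltr01.
by exists b.
Qed.

End BanachAlgebra.

(** * Support points of separating functionals *)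

Section SeparatingFunctionals.
Context (R : realType) (A : comBanachAlgType R).
Hypotheses (ssA : semisimple A) (MA : condition_M A).
Implicit Types (f : {scalar A}) (a b c : A) (x y z : character A).

Definition separating_functional f :=
  forall a b, a ⋅ b = 0 -> f a = 0 \/ f b = 0.

(** In the sense of distributions, [x] lies in the support of [f]: no
    neighbourhood of [x] carries only elements killed by [f]. *)
Definition support_point f x := forall U : set (character A), nbhs x U ->
  exists2 c, (forall z, ~ U z -> z c = 0) & f c != 0.

Definition bounded_functional f :=
  exists M : R, forall a, rnorm (f a : R[i]^o) <= M * rnorm a.

(** Elements carried by a small neighbourhood of [x], on one of which [f] does
    not vanish, multiply [a] to zero. *)
Lemma separating_functional_local f x a : separating_functional f ->
  support_point f x -> nbhs x [set y : character A | y a = 0] -> f a = 0.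
Proof.
move=> sf fx xa; have [c c0 fc] := fx _ xa.
have : a ⋅ c = 0.
  apply: semisimple_eq0 => // y; rewrite characterM.
  have [->|ya] := pselect (y a = 0); first by rewrite mul0r.
  by rewrite (c0 _ ya) mulr0.
by move=> /sf [//|/eqP]; rewrite (negbTE fc).
Qed.

(** Otherwise each [x] in the support of [a] has a local unit [e x] all of whose
    multiples are killed by [f].  Replacing [a] by the product of [a] with the
    formal factors [1 - e x], for finitely many [x], does not change the value of
    [f], and by compactness some such product is zero. *)
Lemma support_point_exists f a : compactly_supported a -> f a != 0 ->
  exists2 x, support_point f x & gelfand_supp a x.
Proof.
move=> ca fa; apply: contrapT => /forall2NP nosp.
have /choice [e eP] : forall x, exists e, (forall c, f (e ⋅ c) = 0) /\
    (gelfand_supp a x -> nbhs x [set z : character A | z e = 1]).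
  move=> x; have [/existsNP [U /not_implyP [xU fU]]|ax] := nosp x; last first.
    by exists 0; split=> // c; rewrite bmul0l raddf0.
  have [e [e1 /gelfand_eq0_off_supp e0]] := condition_M_bump MA xU; exists e; split=> // c.
  apply/eqP/negPn/negP => fec; apply: fU; exists (e ⋅ c) => // z Uz.
  by rewrite characterM e0 // mul0r.
pose g := foldr (fun x c => c - e x ⋅ c) a.
have fg s : f (g s) = f a.
  by elim: s => //= x s IH; rewrite raddfB /= (eP x).1 subr0.
have g0 z s : z a = 0 -> z (g s) = 0.
  by move=> za; elim: s => //= x s IH; rewrite raddfB /= characterM IH mulr0 subr0.
have g1 x z (s : seq (character A)) : x \in s -> z (e x) = 1 -> z (g s) = 0.
  move=> + xz; elim: s => //= x' s IH; rewrite inE => /orP [/eqP <-|xs].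
    by rewrite raddfB /= characterM xz mul1r subrr.
  by rewrite raddfB /= characterM IH // mulr0 subr0.
(* Compactness enters through the filter of large finite sets of factors. *)
pose F := filter_from [set: seq (character A)] (fun s => [set t : seq (character A) | {subset s <= t}]).
have FF : Filter F.
  apply: filter_from_filter; first by exists [::].
  move=> s t _ _; exists (s ++ t) => // r /= str.
  by split=> x xs; apply: str; rewrite mem_cat xs ?orbT.
have /compact_near_coveringP /(_ _ F (fun s z => z (g s) = 0) FF) : compact (gelfand_supp a).
  exact: ca.
move=> [x ax|s _ /(_ s) sa].
  exists ([set z : character A | z (e x) = 1], [set t : seq (character A) | x \in t]).
    split=> /=; first exact: (eP x).2.
    by exists [:: x] => // t /= xt; apply: xt; rewrite mem_head.
  by move=> [z t] /= [xz xt]; apply: g1 xz.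
move/eqP: fa; apply; rewrite -(fg s).
suff -> : g s = 0 by rewrite raddf0.
apply: semisimple_eq0 => // z.
have [/eqP za|za] := boolP (z a == 0); first exact: g0.
by apply: sa => //; apply: subset_closure.
Qed.

(** For [x a = 0], condition (M) gives local units [b] at [x] with [b a] small;
    as [a - b a] vanishes near [x], [f a = f (b a)] is small.  So [f] vanishes on
    the kernel of [x]. *)
Lemma bounded_separating_functional f x : separating_functional f ->
  bounded_functional f -> support_point f x ->
  exists2 k : R[i], k != 0 & forall a, f a = k * x a.
Proof.
move=> sf [M fM] fx.
have M0 : 0 <= `|M| + 1 by rewrite addr_ge0.
have ker a : x a = 0 -> f a = 0.
  move=> xa; apply: (rnorm_small_eq0 (V := R[i]^o)) => e e0.
  have M1 : 0 < `|M| + 1 by rewrite ltr_wpDl.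
  have [b [b1 _ be]] :=
    condition_M_unit MA xa (filterT : nbhs x setT) (divr_gt0 e0 M1).
  have fab : f (a - b ⋅ a) = 0.
    apply: (separating_functional_local sf fx); apply: filterS b1 => y /= yb.
    by rewrite raddfB /= characterM yb mul1r subrr.
  have -> : f a = f (b ⋅ a) by apply/eqP; rewrite -subr_eq0 -raddfB; apply/eqP.
  apply: le_trans (fM _) _.
  apply: (@le_trans _ _ ((`|M| + 1) * rnorm (b ⋅ a))).
    by apply: ler_wpM2r; [apply: rnorm_ge0|have := ler_norm M; lra].
  by rewrite mulrC -ler_pdivlMr // ltW.
have [a xa] := character_neq0 x.
have fE b : f b = f a / x a * x b.
  have : f (b - (x b / x a) *: a) = 0.
    by apply: ker; rewrite raddfB /= scalarZ divfK // subrr.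
  rewrite raddfB /= scalarZ => /eqP; rewrite subr_eq0 => /eqP ->.
  by rewrite mulrC mulrA [RHS]mulrAC.
exists (f a / x a) => //; have [c _ fc] := fx setT filterT.
by apply: contraNneq fc => k0; rewrite fE k0 mul0r.
Qed.

End SeparatingFunctionals.

(** * The closed graph theorem over the complex numbers *)

Section ClosedGraph.
Context (R : realType) (V W : completeNormedModType R[i]) (T : {linear V -> W}).

(** The Baire category step, by nested balls: were the claim false, every ball
    would contain, for each [n], a smaller ball on which [T] exceeds [n] in norm,
    and [T] would be infinite at a common point of these balls. *)
Lemma exists_ball_closure_bounded_image : exists (n : nat) (v0 : V) (r : R),
  0 < r /\ forall v, rnorm (v - v0) < r -> forall e, 0 < e ->
    exists2 u, rnorm (u - v) < e & rnorm (T u) <= n%:R.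
Proof.
apply: contrapT => noball.
have next (p : nat * (V * R)) : exists q : V * R, 0 < p.2.2 ->
    [/\ 0 < q.2, q.2 <= p.2.2 / 2, rnorm (q.1 - p.2.1) <= p.2.2
      & forall u, rnorm (u - q.1) <= 2 * q.2 -> p.1%:R < rnorm (T u)].
  case: p => n [v0 r] /=; have [r0|] := boolP (0 < r); last by exists (0, 0).
  have : ~ forall v, rnorm (v - v0) < r -> forall e, 0 < e ->
      exists2 u, rnorm (u - v) < e & rnorm (T u) <= n%:R.
    by move=> h; apply: noball; exists n, v0, r.
  move=> /existsNP [v /not_implyP [vr /existsNP [e /not_implyP [e0 noU]]]].
  (* Twice the new radius stays below [e], so the limit, which is within twice
     the radius of the centre, still lies in the good ball. *)
  exists (v, Num.min (r / 2) (e / 3)) => _ /=; split.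
  - by rewrite lt_min !divr_gt0.
  - by rewrite ge_min lexx.
  - exact: ltW.
  - move=> u; rewrite ltNge => ue; apply/negP => Tu; apply: noU; exists u => //.
    have : Num.min (r / 2) (e / 3) <= e / 3 by rewrite ge_min lexx orbT.
    lra.
have /choice [step stepP] := next.
pose st := fix st n : V * R := if n is m.+1 then step (m, st m) else (0, 1).
have st0 n : 0 < (st n).2.
  by elim: n => [//|n IH] /=; have [] := stepP (n, st n) IH.
have [s sP] : exists s, forall n, rnorm (s - (st n).1) <= 2 * (st n).2.
  apply: halving_sequence_limit => n;
    by have [] := stepP (n, st n) (st0 n).
have big n : n%:R < rnorm (T s).
  by have [_ _ _] := stepP (n, st n) (st0 n); apply; apply: (sP n.+1).
have := big (Num.truncn (rnorm (T s))).+1.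
by rewrite ltNge ltW // truncnS_gt.
Qed.

(** Differences of points of the ball fill a ball around 0, and homogeneity
    turns the bound on that ball into one proportional to [rnorm v]. *)
Lemma approx_preimage : exists2 C : R, 0 <= C & forall v e, 0 < e ->
  exists2 u, rnorm (u - v) < e & rnorm (T u) <= C * rnorm v.
Proof.
have [n [v0 [r [r0 ball]]]] := exists_ball_closure_bounded_image.
have ball0 v e : rnorm v < r -> 0 < e ->
    exists2 u, rnorm (u - v) < e & rnorm (T u) <= 2 * n%:R.
  move=> vr e0; have e20 : 0 < e / 2 by rewrite divr_gt0.
  have [|u1 u1v Tu1] := ball (v0 + v) _ _ e20.
    by rewrite addrAC subrr add0r.
  have [|u0 u0v Tu0] := ball v0 _ _ e20; first by rewrite subrr rnorm0.
  exists (u1 - u0); last first.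
    by rewrite raddfB; have := rnormB (T u1) (T u0); lra.
  have -> : u1 - u0 - v = (u1 - (v0 + v)) - (u0 - v0).
    by rewrite [v0 + v]addrC !opprD !opprK !addrA [RHS]addrAC subrK addrAC.
  have := rnormB (u1 - (v0 + v)) (u0 - v0); lra.
exists (4 * n%:R / r) => [|v e e0].
  by rewrite divr_ge0 ?mulr_ge0 // ltW.
have [->|v0'] := eqVneq v 0.
  by exists 0; rewrite ?subrr ?raddf0 !rnorm0 ?mulr0.
have Nv := rnorm_gt0 v0'.
pose t := r / (2 * rnorm v).
have t0 : 0 < t by rewrite divr_gt0 // mulr_gt0.
have tv : t * rnorm v = r / 2.
  by rewrite /t; field; rewrite gt_eqF.
have [||u uv Tu] := ball0 (t%:C *: v) (t * e).
- by rewrite rnormZr ?ltW // tv; lra.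
- exact: mulr_gt0.
have tC : t%:C != 0 by rewrite (inj_eq (@complexI R)) gt_eqF.
have uE : u = t%:C *: (t%:C^-1 *: u) by rewrite scalerA mulfV // scale1r.
exists (t%:C^-1 *: u).
  by move: uv; rewrite {1}uE -scalerBr rnormZr ?ltW // ltr_pM2l.
have : t * rnorm (T (t%:C^-1 *: u)) <= 2 * n%:R.
  rewrite -(rnormZr _ (ltW t0)).
  have <- : T (t%:C *: (t%:C^-1 *: u)) = t%:C *: T (t%:C^-1 *: u) by rewrite linearZ.
  by rewrite -uE.
move=> Tu_le; rewrite -(ler_pM2l t0); apply: le_trans Tu_le _.
rewrite mulrCA tv.
suff -> : 4 * n%:R / r * (r / 2) = 2 * n%:R :> R by [].
by field; rewrite gt_eqF.
Qed.

(** Iterating [approx_preimage] on the successive remainders [w n] writes [v] as a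
    series whose image under [T] is dominated by a geometric series; closedness
    identifies the sum of the images with [T v]. *)
Theorem closed_graph :
  (forall v w, (forall e : R, 0 < e ->
     exists2 u, rnorm (u - v) < e & rnorm (T u - w) < e) -> T v = w) ->
  exists M : R, forall v, rnorm (T v) <= M * rnorm v.
Proof.
move=> closedT; have [C C0 CP] := approx_preimage.
exists (2 * C) => v.
have [->|v0] := eqVneq v 0; first by rewrite raddf0 !rnorm0 mulr0.
have Nv := rnorm_gt0 v0.
have half_gt0 n : 0 < (2^-1) ^+ n :> R by rewrite exprn_gt0.
have /choice [u uP] (p : nat * V) : exists u,
    rnorm (u - p.2) < rnorm v * (2^-1) ^+ p.1.+1 /\ rnorm (T u) <= C * rnorm p.2.
  by have [|u] := CP p.2 (rnorm v * (2^-1) ^+ p.1.+1); [exact: mulr_gt0|exists u].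
pose w := fix w n : V := if n is m.+1 then w m - u (m, w m) else v.
have w_le n : rnorm (w n) <= rnorm v * (2^-1) ^+ n.
  case: n => [|n]; first by rewrite expr0 mulr1.
  by rewrite /= rnormBC ltW //; apply: (uP (n, w n)).1.
have wE n : \sum_(k < n) T (u (val k, w (val k))) = T (v - w n).
  elim: n => [|n IH]; first by rewrite big_ord0 subrr raddf0.
  by rewrite big_ord_recr /= IH -raddfD opprB addrA addrAC.
have [|s sP] := @geometric_series_limit _ W (fun k => T (u (k, w k))) (C * rnorm v).
  move=> n; apply: le_trans (uP (n, w n)).2 _; rewrite -mulrA.
  by apply: ler_wpM2l => //; apply: w_le.
have -> : T v = s.
  apply: closedT => e e0.
  have [n nP] := half_pow_lt ((1 + 2 * C) * rnorm v) e0.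
  have b1 : 0 <= rnorm v * (2^-1) ^+ n by apply: mulr_ge0; apply: ltW.
  have b2 : 0 <= C * (rnorm v * (2^-1) ^+ n) by apply: mulr_ge0.
  rewrite -mulrA mulrDl mul1r -mulrA in nP.
  exists (v - w n); first by rewrite addrAC subrr add0r rnormN; have := w_le n; lra.
  by rewrite -wE rnormBC; have := sP n; rewrite -mulrA; lra.
have := sP 0%N; rewrite big_ord0 subr0 expr0 mulr1 mulrA.
exact.
Qed.

End ClosedGraph.

(** * Automatic continuity of separating bijections *)

Section SeparatingOperators.
Context (R : realType) (A B : comBanachAlgType R) (T : {linear A -> B}).
Hypotheses (tauA : tauberian A) (ssB : semisimple B) (MA : condition_M A).
Hypotheses (injT : forall a, T a = 0 -> a = 0) (surjT : forall b, exists a, T a = b).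
Hypothesis sepT : separating T.
Implicit Types (a c : A) (x z : character A) (y : character B).

Let ssA : semisimple A := tauA.1.

Definition pullback y : {scalar A} := (y : {scalar B}) \o T.

Lemma pullback_separating y : separating_functional (pullback y).
Proof.
move=> a c /sepT ac0; have : y (T a ⋅ T c) = 0 by rewrite ac0 raddf0.
move/eqP; rewrite characterM.
by rewrite mulf_eq0 => /orP [] /eqP; [left|right].
Qed.

(** A nonzero element with compact support inside [U] has a nonzero image, which
    is seen by some [y]; the support point found for [y] lies in [U]. *)
Lemma support_points_dense (U : set (character A)) : open U -> U !=set0 ->
  exists y x, U x /\ support_point (pullback y) x.
Proof.
move=> oU [x0 Ux0].
have [a xa] := character_neq0 x0.
have xa_gt0 := rnorm_gt0 (V := R[i]^o) xa.
(* The density of compactly supported elements supplies one that does not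
   vanish at [x0], so the character space is locally compact. *)
have [|c cc ac] := @tauberian_approx _ _ a (rnorm (x0 a : R[i]^o) / 2) tauA.
  by rewrite divr_gt0.
have xc : x0 c != 0.
  apply/eqP => xc; have := character_bounded x0 (a - c).
  by rewrite raddfB /= xc subr0; lra.
have [e [e1 eU]] := condition_M_bump MA (open_nbhs_nbhs (conj oU Ux0)).
have xec : x0 (e ⋅ c) != 0.
  by rewrite characterM (nbhs_singleton e1) mul1r.
have supp_sub : gelfand_supp (e ⋅ c) `<=` gelfand_supp e `&` gelfand_supp c.
  move=> x xs; split; apply: closureS xs => z /=;
  by rewrite /gelfand characterM mulf_eq0 negb_or => /andP [].
have cec : compactly_supported (e ⋅ c).
  apply: (subclosed_compact _ cc); first exact: closed_closure.
  by move=> x /supp_sub [].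
have [y yT] : exists y, y (T (e ⋅ c)) <> 0.
  apply/existsNP => yT; move/eqP: xec; apply.
  by rewrite (injT (semisimple_eq0 ssB yT)) raddf0.
have [x fx xs] := support_point_exists ssA MA (f := pullback y) cec (introN eqP yT).
by exists y, x; split=> //; apply: eU; have [] := supp_sub _ xs.
Qed.

Lemma unbounded_small_large (f : {scalar A}) (d K : R) : 0 < d ->
  ~ bounded_functional f ->
  exists2 a, rnorm a <= d & K < rnorm (f a : R[i]^o).
Proof.
move=> d0 ub; have [a fa] : exists a, `|K| / d * rnorm a < rnorm (f a : R[i]^o).
  apply: contrapT => noa; apply: ub; exists (`|K| / d) => a.
  by rewrite leNgt; apply/negP => fa; apply: noa; exists a.
have a0 : 0 < rnorm a.
  apply: rnorm_gt0; apply/eqP => a0.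
  by move: fa; rewrite a0 raddf0 !rnorm0 mulr0 ltxx.
have t0 : 0 < d / rnorm a by rewrite divr_gt0.
exists ((d / rnorm a)%:C *: a); first by rewrite rnormZr ?divfK ?gt_eqF // ltW.
rewrite scalarZ /= rnormM rnorm_real ?ltW //.
apply: le_lt_trans (ler_norm K) _.
move: fa; rewrite -(ltr_pM2l t0); congr (_ < _).
by field; rewrite !gt_eqF.
Qed.

(** The sliding hump.  [G] has no isolated point, since the functional at a
    support point that is isolated is a multiple of evaluation, hence bounded.
    So [G] contains infinitely many disjoint open sets [U n], and unboundedness
    gives elements [a n] of norm at most [2^-n], carried by [U n], with
    [y n (T (a n))] larger than [n].  Their sum [s] agrees with [a n] near the
    support point of [y n], so [y n (T s)] is larger than [n] for every [n]. *)
Lemma no_open_set_of_unbounded_pullbacks (G : set (character A)) :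
  open G -> G !=set0 ->
  (forall y x, G x -> support_point (pullback y) x ->
     ~ bounded_functional (pullback y)) -> False.
Proof.
move=> oG G0 Gub.
pose S := [set U : set (character A) | [/\ open U, U !=set0 & U `<=` G]].
(* Two distinct points of an open subset of [G], separated by disjoint open
   sets; iterating on the second half produces the sequence [U n]. *)
have split_open U : S U -> exists p : set (character A) * set (character A),
    [/\ S p.1, S p.2, p.1 `<=` U, p.2 `<=` U & p.1 `&` p.2 = set0].
  move=> [oU U0 UG].
  have [x [z [Ux Uz xz]]] : exists x z, [/\ U x, U z & x <> z].
    have [y [x [Ux fx]]] := support_points_dense oU U0.
    have ub := Gub _ _ (UG _ Ux) fx.
    apply: contrapT => noxz; apply: ub.
    have [e [e1 eU]] := condition_M_bump MA (open_nbhs_nbhs (conj oU Ux)).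
    exists (rnorm (pullback y e : R[i]^o) * 2) => c.
    have -> : pullback y c = pullback y e * x c.
      apply/eqP; rewrite mulrC -[x c * _]scalarZ -subr_eq0 -raddfB; apply/eqP.
      apply: (separating_functional_local ssA (@pullback_separating y) fx).
      apply: filterS (open_nbhs_nbhs (conj oU Ux)) => z Uz /=.
      have -> : z = x by apply: contrapT => zx; apply: noxz; exists z, x.
      by rewrite raddfB /= scalarZ /= (nbhs_singleton e1) mulr1 subrr.
    rewrite rnormM -mulrA; apply: ler_wpM2l; first exact: rnorm_ge0.
    exact: character_bounded.
  have := @character_space_hausdorff R A; rewrite open_hausdorff.
  move=> /(_ x z (introN eqP xz)) [[V W]] /=; rewrite !inE => -[Vx Wz] [oV oW VW].
  exists (U `&` V, U `&` W); split=> /=; try by move=> ? [].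
  - by split; [exact: openI|exists x|move=> ? [/UG]].
  - by split; [exact: openI|exists z|move=> ? [/UG]].
  - by rewrite setIACA VW setI0.
have /choice [p pP] U : exists p : set (character A) * set (character A), S U ->
    [/\ S p.1, S p.2, p.1 `<=` U, p.2 `<=` U & p.1 `&` p.2 = set0].
  have [/split_open [p pP]|] := pselect (S U); first by exists p.
  by exists (set0, set0).
pose H n := iter n (fun U => (p U).2) G.
pose U n := (p (H n)).1.
have SH n : S (H n).
  by elim: n => [|n /pP []]; [split|].
have HS n k : H (n + k)%N `<=` H n.
  elim: k => [|k IH]; first by rewrite addn0.
  by rewrite addnS => x; have [_ _ _ + _] := pP _ (SH (n + k)%N); move=> /[apply] /IH.
have U_disj_lt n m z : (n < m)%N -> U n z -> ~ U m z.
  move=> nm Unz Umz; have [_ _ _ _ pp] := pP _ (SH n).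
  suff : set0 z by []. rewrite -pp; split=> //.
  have [_ _ Um _ _] := pP _ (SH m).
  by have := Um _ Umz; rewrite -(subnKC nm) => /HS.
have U_disj n m z : n != m -> U n z -> ~ U m z.
  rewrite neq_ltn => /orP [|mn Un Um]; first exact: U_disj_lt.
  exact: (U_disj_lt _ _ _ mn Um Un).
have /choice [ya yaP] n : exists ya : character B * A,
    [/\ exists2 x, U n x & support_point (pullback ya.1) x,
        rnorm ya.2 <= 1 * (2^-1) ^+ n,
        forall z, ~ U n z -> z ya.2 = 0
      & n%:R < rnorm (ya.1 (T ya.2) : R[i]^o)].
  have [[oU U0 UG] _ _ _ _] := pP _ (SH n).
  have [y [x [Ux fx]]] := support_points_dense oU U0.
  have [e [e1 eU]] := condition_M_bump MA (open_nbhs_nbhs (conj oU Ux)).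
  have e_gt0 : 0 < rnorm e + 1 by rewrite ltr_wpDl ?rnorm_ge0.
  have pow_gt0 : 0 < (2^-1) ^+ n :> R by rewrite exprn_gt0.
  have [c cd fc] := unbounded_small_large n%:R (divr_gt0 pow_gt0 e_gt0)
    (Gub _ _ (UG _ Ux) fx).
  exists (y, e ⋅ c); split=> /=.
  - by exists x.
  - rewrite mul1r; apply: le_trans (rnorm_bmul _ _) _.
    apply: (@le_trans _ _ ((rnorm e + 1) * rnorm c)).
      by apply: ler_wpM2r; [exact: rnorm_ge0|rewrite lerDl].
    by rewrite mulrC -ler_pdivlMr.
  - by move=> z Uz; rewrite characterM (gelfand_eq0_off_supp eU) // mul0r.
  - suff -> : y (T (e ⋅ c)) = y (T c) by [].
    apply/eqP; rewrite -subr_eq0; apply/eqP.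
    have := separating_functional_local ssA (@pullback_separating y) fx (a := e ⋅ c - c).
    rewrite raddfB /=; apply; apply: filterS e1 => z /= ze.
    by rewrite raddfB /= characterM ze mul1r subrr.
(* [s] is the superposition of the disjoint humps. *)
have [|s sP] := @geometric_series_limit _ A (fun n => (ya n).2) 1.
  by move=> n; have [] := yaP n.
have sE n z : U n z -> z s = z (ya n).2.
  move=> Unz; apply/eqP; rewrite -subr_eq0; apply/eqP.
  apply: (rnorm_half_pow_eq0 (V := R[i]^o) (C := 4 * (2^-1) ^+ n.+1)) => k.
  have := character_bounded z (s - \sum_(j < n.+1 + k) (ya j).2).
  rewrite raddfB raddf_sum /=.
  have nk : (n < n.+1 + k)%N by rewrite ltn_addr.
  rewrite (bigD1 (Ordinal nk)) //= big1 ?addr0 => [|j jn]; last first.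
    have [_ _ off _] := yaP j; apply: off; apply: U_disj Unz.
    by apply: contra jn => /eqP nj; apply/eqP/val_inj.
  have := sP (n.+1 + k)%N; rewrite mul1r exprD; lra.
have big n : n%:R < 2 * rnorm (T s).
  have [[x Ux fx] _ _ h] := yaP n.
  apply: lt_le_trans (character_bounded (ya n).1 (T s)).
  suff -> : (ya n).1 (T s) = (ya n).1 (T (ya n).2) by [].
  apply/eqP; rewrite -subr_eq0; apply/eqP.
  have := separating_functional_local ssA (@pullback_separating (ya n).1) fx
    (a := s - (ya n).2).
  rewrite raddfB /=; apply.
  have [[oU _ _] _ _ _ _] := pP _ (SH n).
  apply: filterS (open_nbhs_nbhs (conj oU Ux)) => z Uz /=.
  by rewrite raddfB /= (sE n z Uz) subrr.
have := big (Num.truncn (2 * rnorm (T s))).+1.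
by rewrite ltNge ltW // truncnS_gt.
Qed.

(** On the set where the transform of [c] is nonzero, a bounded functional would
    be a nonzero multiple of a character not vanishing at [c]; so all
    functionals supported there are unbounded. *)
Lemma eq0_of_bounded_pullbacks c :
  (forall y, bounded_functional (pullback y) -> y (T c) = 0) -> c = 0.
Proof.
move=> yc; apply: semisimple_eq0 => // x0; apply/eqP/negPn/negP => xc.
apply: (@no_open_set_of_unbounded_pullbacks [set x | gelfand c x != 0]).
- exact: open_gelfand_neq0.
- by exists x0.
move=> y x /= xc' fx bf.
have [k k0 kE] := bounded_separating_functional ssA MA (@pullback_separating y) bf fx.
have := yc _ bf; have := kE c => /= -> /eqP.
by rewrite mulf_eq0 (negbTE k0) (negbTE xc').
Qed.

Lemma separating_bijection_bounded :
  exists M : R, forall a, rnorm (T a) <= M * rnorm a.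
Proof.
apply: closed_graph => v w vw; have [a aw] := surjT w.
suff : v - a = 0 by rewrite -aw => /eqP; rewrite subr_eq0 => /eqP ->.
apply: eq0_of_bounded_pullbacks => y [M yM].
apply: (rnorm_small_eq0 (V := R[i]^o)) => e e0.
have M1 : 0 < `|M| + 2 by rewrite ltr_wpDl.
have [u uv uw] := vw _ (divr_gt0 e0 M1).
rewrite raddfB /= aw; have -> : T v - w = (T u - w) - T (u - v).
  by rewrite [T (u - v)]raddfB opprB [RHS]addrC addrA subrK.
rewrite raddfB; apply: le_trans (rnormB _ _) _.
have h1 := character_bounded y (T u - w).
have h2 := yM (u - v).
have h3 : M * rnorm (u - v) <= `|M| * rnorm (u - v).
  by apply: ler_wpM2r; [exact: rnorm_ge0|exact: ler_norm].
have h4 : (`|M| + 2) * (e / (`|M| + 2)) = e by rewrite mulrC divfK // gt_eqF.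
set d := e / _ in uv uw h4.
have h5 : `|M| * rnorm (u - v) <= `|M| * d by apply: ler_wpM2l => //; apply: ltW.
move: h2 => /=; lra.
Qed.

Lemma pullback_bounded y : bounded_functional (pullback y).
Proof.
have [M TM] := separating_bijection_bounded.
exists (2 * M) => a /=; apply: le_trans (character_bounded _ _) _.
by rewrite -mulrA ler_pM2l.
Qed.

(** A functional without support point kills all compactly supported elements;
    these are dense and the functional is bounded, so it would vanish, while
    [T] is surjective. *)
Lemma support_point_total y : exists x, support_point (pullback y) x.
Proof.
have [c cc fc] : exists2 c, compactly_supported c & pullback y c != 0.
  apply: contrapT => /forall2NP noc.
  have [b yb] := character_neq0 y; have [a aE] := surjT b.
  move/eqP: yb; apply; rewrite -aE.
  apply: (rnorm_small_eq0 (V := R[i]^o)) => e e0.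
  have [K yK] := pullback_bounded y.
  have K1 : 0 < `|K| + 1 by rewrite ltr_wpDl.
  have [c cc ac] := tauberian_approx a tauA (divr_gt0 e0 K1).
  have yc : y (T c) = 0.
    by have [/(_ cc)|/negP /negPn /eqP] := noc c.
  have := yK (a - c); rewrite raddfB /= yc subr0 => /le_trans; apply.
  apply: (@le_trans _ _ ((`|K| + 1) * rnorm (a - c))).
    by apply: ler_wpM2r; [exact: rnorm_ge0|have := ler_norm K; lra].
  by rewrite mulrC -ler_pdivlMr // ltW.
by have [x fx _] := support_point_exists ssA MA cc fc; exists x.
Qed.

Lemma pullback_at_support_point y x : support_point (pullback y) x ->
  exists2 k : R[i], k != 0 & forall a, y (T a) = k * x a.
Proof.
move=> fx; exact: (bounded_separating_functional ssA MA (@pullback_separating y)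
  (pullback_bounded y) fx).
Qed.

Lemma separating_bijection_inverse_separating a c : T a ⋅ T c = 0 -> a ⋅ c = 0.
Proof.
move=> ac0; apply: semisimple_eq0 => // x0; apply/eqP/negPn/negP => xac.
have [y [x [/= xac' fx]]] := support_points_dense
  (@open_gelfand_neq0 _ _ (a ⋅ c)) (ex_intro _ x0 xac).
have [k k0 kE] := pullback_at_support_point fx.
have /eqP : y (T a ⋅ T c) = 0 by rewrite ac0 raddf0.
rewrite characterM !kE mulrACA -characterM !mulf_eq0 (negbTE k0) /=.
by move: xac'; rewrite /gelfand => /negbTE ->.
Qed.

End SeparatingOperators.

(** * The weight of a composition operator as a multiplier symbol *)

Section DualNorm.
Context (R : realType) (B : comBanachAlgType R).
Implicit Types (b : B) (y : character B).

Lemma net_filter_proper (I : Type) (le : I -> I -> Prop) :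
  directed le -> ProperFilter (net_filter le).
Proof.
move=> [[i0] lexx le_trans le_dir]; split.
  by move=> [i /(_ i (lexx i))].
split.
- by exists i0.
- move=> P Q [i iP] [j jQ]; have [k [ik jk]] := le_dir i j.
  by exists k => l kl; split; [apply: iP|apply: jQ]; apply: le_trans kl.
- by move=> P Q PQ [i iP]; exists i => j ij; apply/PQ/iP.
Qed.

Lemma rnorm_le_dual_norm (f : {scalar B}) (d : R) b :
  dual_norm f = d%:E -> rnorm (f b : R[i]^o) <= d * rnorm b.
Proof.
move=> fd; have [->|b0] := eqVneq b 0; first by rewrite raddf0 !rnorm0 mulr0.
have Nb := rnorm_gt0 b0.
have Nb' : 0 <= (rnorm b)^-1 by rewrite invr_ge0 ltW.
rewrite -ler_pdivrMr //.
have : ((rnorm (f ((rnorm b)^-1%:C *: b) : R[i]^o))%:E <= dual_norm f)%E.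
  apply: ereal_sup_ubound; exists ((rnorm b)^-1%:C *: b) => //=.
  by rewrite rnormZr // mulVf // gt_eqF.
by rewrite fd lee_fin scalarZ /= rnormM rnorm_real // mulrC.
Qed.

Lemma dual_norm_ge0 (f : {scalar B}) : (0 <= dual_norm f)%E.
Proof.
apply: ereal_sup_ubound; exists 0; rewrite /= ?raddf0 ?rnorm0 //.
Qed.

(** Named so that the functionals in the BSE-condition carry a linear
    structure. *)
Definition character_combination (alpha : character B -> R[i]) (ys : seq (character B)) b :=
  \sum_(y <- ys) alpha y * y b.

Lemma character_combination_scalar alpha ys : scalar (character_combination alpha ys).
Proof.
move=> c b b'; rewrite /character_combination mulr_sumr -big_split /=.
by apply: eq_bigr => y _; rewrite linearP /= mulrDr mulrCA.
Qed.

HB.instance Definition _ alpha ys := GRing.isLinear.Build R[i] B R[i] _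
  (character_combination alpha ys) (character_combination_scalar alpha ys).

End DualNorm.

Section Weights.
Context (R : realType) (A B : comBanachAlgType R) (T : {linear A -> B}).
Context (h : character B -> character A) (kappa : character B -> R[i]).
Hypotheses (surjT : forall b, exists a, T a = b).
Hypotheses (kappa_neq0 : forall y, kappa y != 0).
Hypothesis (TE : forall (y : character B) (a : A), y (T a) = kappa y * h y a).

(** Since [y (T a) = kappa y * h y a] and [y (T (a a)) = kappa y * (h y a)^2],
    the weight is the quotient of [y (T a)^2] by [y (T (a a))], and [h] drops
    out. *)
Lemma weight_continuous : continuous (kappa : character B -> R[i]^o).
Proof.
move=> y0; have [b yb] := character_neq0 y0; have [a aE] := surjT b.
have kE (y : character B) : y b != 0 -> kappa y = y b * y b * (y (T (a ⋅ a)))^-1.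
  rewrite -aE !TE characterM mulf_eq0 negb_or (kappa_neq0 y) /= => ha.
  by field; rewrite ha kappa_neq0.
have yaa : y0 (T (a ⋅ a)) != 0.
  by move: yb; rewrite -aE !TE characterM !mulf_eq0 !negb_or kappa_neq0 /= => ->.
pose g (y : character B) : R[i]^o := gelfand b y * gelfand b y * (gelfand (T (a ⋅ a)) y)^-1.
have gc : g y @[y --> y0] --> g y0.
  apply: (cvgM (cvgM (@gelfand_continuous _ _ _ y0) (@gelfand_continuous _ _ _ y0))).
  exact: (cvgV yaa (@gelfand_continuous _ _ _ y0)).
rewrite /continuous_at (kE _ yb).
apply: (cvg_trans _ gc); apply: (@near_eq_cvg _ _ (nbhs y0) _ g kappa).
apply: filterS (open_nbhs_nbhs (conj (@open_gelfand_neq0 _ _ b) yb)) => y yb' /=.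
by rewrite /g kE.
Qed.

(** The values [kappa y] are the limits of [y (T (e i))], because [h y (e i)]
    tends to 1, and the elements [T (e i)] stay bounded in norm. *)
Lemma weight_BSE (K : R) :
  has_bounded_approx_identity A K ->
  (exists M : R, forall a, rnorm (T a) <= M * rnorm a) ->
  BSE_condition kappa.
Proof.
move=> [I [le [e [le_dir e_le e_id]]]] [M TM].
have FF := net_filter_proper le_dir.
have C0 : 0 < `|M| * `|K| + 1 by rewrite ltr_wpDl // mulr_ge0.
exists (`|M| * `|K| + 1) => // ys alpha _.
rewrite -[dual_norm _]/(dual_norm (character_combination alpha ys)).
have := dual_norm_ge0 (character_combination alpha ys).
case dE : (dual_norm _) => [d| |] //; last by rewrite gt0_muley ?lte_fin ?leey.
rewrite lee_fin => d0; rewrite -EFinM lee_fin.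
have Te i : rnorm (character_combination alpha ys (T (e i)) : R[i]^o) <=
    (`|M| * `|K| + 1) * d.
  apply: le_trans (rnorm_le_dual_norm _ dE) _.
  rewrite mulrC ler_wpM2r //; apply: le_trans (TM _) _.
  apply: (@le_trans _ _ (`|M| * `|K|)); last by rewrite lerDl.
  apply: (@le_trans _ _ (`|M| * rnorm (e i))).
    by apply: ler_wpM2r; [exact: rnorm_ge0|exact: ler_norm].
  by apply: ler_wpM2l => //; apply: le_trans (e_le i) (ler_norm K).
have cvg1 (x : character A) : x (e i) @[i --> net_filter le] --> (1 : R[i]^o).
  have [a xa] := character_neq0 x.
  apply/cvg_rnormP => r r0.
  have xa0 := rnorm_gt0 (V := R[i]^o) xa.
  have /cvg_rnormP /(_ (r * rnorm (x a : R[i]^o) / 2)) := e_id a.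
  rewrite divr_gt0 ?mulr_gt0 // => /(_ isT); apply: filterS => i ei.
  rewrite -(ltr_pM2r xa0) -rnormM mulrBl mul1r -characterM.
  have := character_bounded x (e i ⋅ a - a); rewrite raddfB /=; lra.
have cvgk : character_combination alpha ys (T (e i)) @[i --> net_filter le] -->
    (\sum_(y <- ys) alpha y * kappa y : R[i]^o).
  rewrite /character_combination.
  apply: (@cvg_big (R[i]^o) (character B) +%R 0 xpredT _ _ _ ys (fun y i => alpha y * y (T (e i)))) => [|y _].
    exact: (@pseudometric_normed_Zmodule.add_continuous _ (R[i]^o)).
  apply: cvgMl_tmp.
  under eq_cvg do rewrite TE.
  have k1 := cvgMl_tmp (a := kappa y) (cvg1 (h y)); rewrite mulr1 in k1; exact: k1.
apply/ler_addgt0Pr => r r0.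
have cvgr := (cvg_rnormP (V := R[i]^o) _ _ _).1 cvgk r r0.
have [i ir] := filter_ex (cvgr FF).
have := rnorm_triangle (V := R[i]^o) (character_combination alpha ys (T (e i)))
  (\sum_(y <- ys) alpha y * kappa y) 0.
rewrite !subr0 rnormBC; have := Te i; lra.
Qed.

End Weights.

(** Multiplicativity forces the factor to satisfy [k = k * k]. *)
Lemma proportional_characters (R : realType) (A : comBanachAlgType R)
    (x x' : character A) (k : R[i]) :
  (forall a, x a = k * x' a) -> x = x' /\ k = 1.
Proof.
move=> xk; have [a xa] := character_neq0 x.
have x'a : x' a != 0 by apply: contraNneq xa => x'a; rewrite xk x'a mulr0.
have k0 : k != 0 by apply: contraNneq xa => k0; rewrite xk k0 mul0r.
have k1 : k = 1.
  have := characterM x a a; rewrite !xk characterM mulrACA.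
  move=> /(mulIf (mulf_neq0 x'a x'a)) kk; apply: (mulfI k0).
  by rewrite mulr1 -kk.
by split=> //; apply: character_inj => b; rewrite xk k1 mul1r.
Qed.

Lemma linear_bijection_inverse (R : realType) (A B : comBanachAlgType R)
    (T : {linear A -> B}) : bijective T ->
  exists S : {linear B -> A}, cancel T S /\ cancel S T.
Proof.
move=> [g Tg gT].
have lg : linear g.
  by move=> c b b'; apply: (can_inj Tg); rewrite linearP !gT.
pose S : {linear B -> A} := HB.pack g (GRing.isLinear.Build _ _ _ _ g lg).
by exists S.
Qed.

Lemma weighted_composition_multiplier (R : realType) (A B : comBanachAlgType R)
    (T : {linear A -> B}) :
  tauberian A -> semisimple B -> condition_M A -> BSE_algebra B ->
  has_bounded_approx_identity A 1 -> separating T -> bijective T ->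
  exists (h : character B -> character A) (kappa : character B -> R[i]) (S : B -> B),
    [/\ linear S, forall (y : character B) (b : B), y (S b) = kappa y * y b
      & forall (y : character B) (a : A), y (T a) = kappa y * h y a].
Proof.
move=> tauA ssB MA bseB baiA sepT [g Tg gT].
have injT a : T a = 0 -> a = 0 by move=> Ta; rewrite -(Tg a) Ta -(raddf0 T) Tg.
have surjT b : exists a, T a = b by exists (g b).
have /choice [hk hkP] (y : character B) : exists hk : character A * R[i],
    hk.2 != 0 /\ forall a, y (T a) = hk.2 * hk.1 a.
  have [x fx] := support_point_total tauA ssB MA injT surjT sepT y.
  have [k k0 kE] := pullback_at_support_point tauA ssB MA injT surjT sepT fx.
  by exists (x, k).
pose h y := (hk y).1; pose kappa y := (hk y).2.
have kappa0 y : kappa y != 0 by have [] := hkP y.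
have TE (y : character B) (a : A) : y (T a) = kappa y * h y a by have [] := hkP y.
have : multiplier_symbols kappa.
  rewrite -bseB; split; first exact: (weight_continuous surjT kappa0 TE).
  apply: (weight_BSE TE baiA).
  exact: (separating_bijection_bounded tauA ssB MA injT surjT sepT).
move=> [S [linS _ _] SE]; exists h, kappa, S; split=> // y b; exact: SE.
Qed.

Theorem corollary4p5 (R : realType) (A B : comBanachAlgType R)
    (tauA : tauberian A) (tauB : tauberian B)
    (bseA : BSE_algebra A) (bseB : BSE_algebra B)
    (MA : condition_M A) (MB : condition_M B)
    (baiA : has_bounded_approx_identity A 1)
    (baiB : has_bounded_approx_identity B 1)
    (exT : exists T : {linear A -> B}, bijective T /\ separating T) :
  algebraically_isomorphic A B.
Proof.
have [T [bijT sepT]] := exT.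
have [S [TK SK]] := linear_bijection_inverse bijT.
have ssA := tauA.1; have ssB := tauB.1.
have injT a : T a = 0 -> a = 0 by move=> Ta; rewrite -(TK a) Ta raddf0.
have surjT b : exists a, T a = b by exists (S b).
have sepS : separating S.
  move=> b1 b2 b12.
  apply: (separating_bijection_inverse_separating tauA ssB MA injT surjT sepT).
  by rewrite !SK.
have bijS : bijective S by exists T.
have [h [kappa [NB [linB NBE TE]]]] :=
  weighted_composition_multiplier tauA ssB MA bseB baiA sepT bijT.
have [k [mu [NA [linA NAE SE]]]] :=
  weighted_composition_multiplier tauB ssA MB bseA baiB sepS bijS.
have hkP (x : character A) : h (k x) = x /\ mu x * kappa (k x) = 1.
  have [|<- ->] // := @proportional_characters _ _ x (h (k x)) (mu x * kappa (k x)).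
  by move=> a; rewrite -{1}(TK a) SE TE mulrA.
have khP (y : character B) : k (h y) = y /\ kappa y * mu (h y) = 1.
  have [|<- ->] // := @proportional_characters _ _ y (k (h y)) (kappa y * mu (h y)).
  by move=> b; rewrite -{1}(SK b) TE SE mulrA.
pose Phi a := T (NA a).
pose Psi b := S (NB b).
have PhiE (y : character B) (a : A) : y (Phi a) = h y a.
  by rewrite TE NAE mulrA (khP y).2 mul1r.
have PsiE (x : character A) (b : B) : x (Psi b) = k x b.
  by rewrite SE NBE mulrA (hkP x).2 mul1r.
have linPhi : linear Phi by move=> c a a'; rewrite /Phi linA linearP.
pose F : {linear A -> B} := HB.pack Phi (GRing.isLinear.Build _ _ _ _ Phi linPhi).
exists F; split.
  exists Psi => [a|b].
    by apply: semisimple_inj => // x; rewrite PsiE PhiE (hkP x).1.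
  by apply: semisimple_inj => // y; rewrite PhiE PsiE (khP y).1.
by move=> a a'; apply: semisimple_inj => // y; rewrite characterM !PhiE characterM.
Qed.
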